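(* Let $f(x)=\theta_{n+1}\,\phi_n(\theta_n\,\phi_{n-1}(\cdots\phi_1(\theta_1x)))$ be a feed-forward network with linear layers $\theta_i\in\mathbb{R}^{d_i\times d_{i-1}}$ and fixed element-wise activations $\phi_i$. Let $M=\max_{1\le i\le n}\sigma_1(\theta_i)$ and let $k\ge1$ be an integer. Then to achieve $\max_i\sigma_1(\theta_i)\le M^{1/k}$ it suffices to insert at most $(k-1)\cdot n$ additional linear layers and perform spectral deformation.
   Context: $\sigma_1(\cdot)$ denotes the largest singular value (spectral norm). Inserting a linear layer means adding an identity linear layer with identity activation adjacent to an existing layer $\theta_i$ (so the computed function is unchanged). Performing spectral deformation means modifying the singular values of $\theta_i=U\Sigma V^\top$, replacing it by $U\widetilde\Sigma V^\top$, and compensating in the inserted adjacent layers (e.g. for one inserted layer, replacing the identity by $U\Sigma\widetilde\Sigma^{-1}U^\top$, with the pseudoinverse in the rectangular case), so that the product of the resulting matrices equals the original $\theta_i$ and the function $f$ is preserved. After the modification, the maximum $\max_i\sigma_1(\theta_i)$ is taken over all linear layers resulting from $\theta_1,\dots,\theta_n$, including the inserted ones. *)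

(* Defs.v *)
From mathcomp Require Import all_boot all_order all_algebra.
From mathcomp Require Import boolp classical_sets reals exp.

Set Implicit Arguments.
Unset Strict Implicit.
Unset Printing Implicit Defensive.
Import Order.TTheory GRing.Theory Num.Theory.

Local Open Scope ring_scope.
Local Open Scope classical_set_scope.

(* If A has more columns than rows, A^T *m A has the eigenvalue 0 even when
   none of the min(m, n) singular values of A is 0; this does not change the
   largest one. *)
Definition singular_value (R : realType) (m n : nat) (A : 'M[R]_(m, n))
  (s : R) : Prop :=
  0 <= s /\ eigenvalue (A^T *m A) (s ^+ 2).

(* The set is finite, so the supremum is a maximum; it is 0 if n = 0. *)
Definition sigma1 (R : realType) (m n : nat) (A : 'M[R]_(m, n)) : R :=
  sup [set s | singular_value A s].

Definition orthogonal_mx (R : realType) (n : nat) (U : 'M[R]_n) : Prop :=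
  U^T *m U = 1%:M.

Definition nneg_diag (R : realType) (m n : nat) (S : 'M[R]_(m, n)) : Prop :=
  is_diag_mx S /\ forall i j, 0 <= S i j.

(* Full decomposition; the diagonal of S need not be sorted. *)
Definition is_svd (R : realType) (m n : nat) (A : 'M[R]_(m, n))
  (U : 'M[R]_m) (S : 'M[R]_(m, n)) (V : 'M[R]_n) : Prop :=
  [/\ orthogonal_mx U, nneg_diag S, orthogonal_mx V & A = U *m S *m V^T].

(* Feed-forward networks from R^p to R^q.  [Hidden A phi N] computes
   N (phi (A x)), and the readout, which is the matrix theta_(n+1) of a
   network with n hidden layers, has no activation. *)
Inductive network (R : realType) (q p : nat) : Type :=
| Readout (A : 'M[R]_(q, p))
| Hidden (m : nat) (A : 'M[R]_(m, p)) (phi : R -> R) (N : network R q m).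

Fixpoint eval (R : realType) (q p : nat) (N : network R q p) :
  'cV[R]_p -> 'cV[R]_q :=
  match N with
  | Readout A => fun x => A *m x
  | Hidden m A phi N' => fun x => eval N' (map_mx phi (A *m x))
  end.

Fixpoint depth (R : realType) (q p : nat) (N : network R q p) : nat :=
  match N with
  | Readout _ => 0%N
  | Hidden _ _ _ N' => (depth N').+1
  end.

(* The readout is left out. *)
Fixpoint hidden_norms (R : realType) (q p : nat) (N : network R q p) : seq R :=
  match N with
  | Readout _ => [::]
  | Hidden _ A _ N' => sigma1 A :: hidden_norms N'
  end.

(* The sigma1 are nonnegative, so the default value 0 only matters for a
   network without hidden layers. *)
Definition max_sigma1 (R : realType) (q p : nat) (N : network R q p) : R :=
  \big[Num.max/0]_(s <- hidden_norms N) s.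

(* A network with inserted linear layers that remembers the layer next to which
   each of them was inserted.  In [XHidden pre A post phi X] the layers of pre
   and of post are square and are listed in their order of application: pre
   before A, post after A and before phi. *)
Inductive xnetwork (R : realType) (q p : nat) : Type :=
| XReadout (A : 'M[R]_(q, p))
| XHidden (m : nat) (pre : seq 'M[R]_p) (A : 'M[R]_(m, p))
    (post : seq 'M[R]_m) (phi : R -> R) (X : xnetwork R q m).

Fixpoint hidden_post (R : realType) (q m p : nat) (A : 'M[R]_(m, p))
  (post : seq 'M[R]_m) (phi : R -> R) (N : network R q m) : network R q p :=
  match post with
  | [::] => Hidden A phi N
  | L :: post' => Hidden A id (hidden_post L post' phi N)
  end.

Definition hidden_pre (R : realType) (q p : nat) (pre : seq 'M[R]_p)
  (N : network R q p) : network R q p :=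
  foldr (fun L N' => Hidden L id N') N pre.

(* The underlying ordinary network; all activations between the layers of a
   block are the identity, and phi comes after its last layer. *)
Fixpoint flatten_net (R : realType) (q p : nat) (X : xnetwork R q p) :
  network R q p :=
  match X with
  | XReadout A => Readout A
  | XHidden _ pre A post phi X' =>
      hidden_pre pre (hidden_post A post phi (flatten_net X'))
  end.

Fixpoint inserted (R : realType) (q p : nat) (X : xnetwork R q p) : nat :=
  match X with
  | XReadout _ => 0%N
  | XHidden _ pre _ post _ X' => (size pre + size post + inserted X')%N
  end.

Inductive insertion (R : realType) (q : nat) :
  forall p : nat, network R q p -> xnetwork R q p -> Prop :=
| InsReadout p (A : 'M[R]_(q, p)) : insertion (Readout A) (XReadout A)
| InsHidden p m (A : 'M[R]_(m, p)) (phi : R -> R) (a b : nat)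
    (N : network R q m) (X : xnetwork R q m) :
    insertion N X ->
    insertion (Hidden A phi N)
      (XHidden (nseq a 1%:M) A (nseq b 1%:M) phi X).

Definition layers_prod (R : realType) (n : nat) (s : seq 'M[R]_n) : 'M[R]_n :=
  foldr (fun L P => P *m L) 1%:M s.

(* The form U D U^T taken by the identity U 1 U^T once its singular values are
   modified, e.g. D = S *m pinv S' to compensate S -> S' on the left. *)
Definition spectral_in (R : realType) (n : nat) (U L : 'M[R]_n) : Prop :=
  exists2 D : 'M[R]_n, nneg_diag D & L = U *m D *m U^T.

(* The layer A = U S V^T becomes U S' V^T, and the identities inserted before
   (after) it become compensating layers in the right (left) singular basis,
   so that the product of the block is still A. *)
Definition block_deformation (R : realType) (m p : nat) (A : 'M[R]_(m, p))
  (pre : seq 'M[R]_p) (A' : 'M[R]_(m, p)) (post : seq 'M[R]_m) : Prop :=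
  exists (U : 'M[R]_m) (S S' : 'M[R]_(m, p)) (V : 'M[R]_p),
    [/\ is_svd A U S V,
        is_svd A' U S' V,
        forall L, L \in pre -> spectral_in V L,
        forall L, L \in post -> spectral_in U L
      & layers_prod post *m A' *m layers_prod pre = A].

(* Intended for a source whose inserted layers are all identities. *)
Inductive spectral_deformation (R : realType) (q : nat) :
  forall p : nat, xnetwork R q p -> xnetwork R q p -> Prop :=
| DefReadout p (A : 'M[R]_(q, p)) :
    spectral_deformation (XReadout A) (XReadout A)
| DefHidden p m (pre pre' : seq 'M[R]_p) (A A' : 'M[R]_(m, p))
    (post post' : seq 'M[R]_m) (phi : R -> R) (X X' : xnetwork R q m) :
    size pre' = size pre -> size post' = size post ->
    block_deformation A pre' A' post' ->
    spectral_deformation X X' ->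
    spectral_deformation (XHidden pre A post phi X)
      (XHidden pre' A' post' phi X').

(* Main.v *)
Require Import Defs.
From mathcomp Require Import all_boot all_order all_algebra.
From mathcomp Require Import boolp classical_sets reals exp.
From mathcomp Require Import complex ring.
Import Order.TTheory GRing.Theory Num.Theory.
Local Open Scope ring_scope.
Set Implicit Arguments.
Unset Strict Implicit.

(** Each hidden layer is treated on its own.  Let A = U S V^T be a singular
    value decomposition and let T be the entrywise k-th root of S.  The layer
    becomes A' = U T V^T, and k - 1 copies of L = U D U^T are inserted after it,
    where D is the square diagonal matrix that carries the diagonal of T, padded
    with zeros if A has more rows than columns.  Since U^T U = 1, and since T and D have the same diagonal,
    L^(k-1) A' = U T^(k) V^T = A, where T^(k) = S is the entrywise k-th power.
    So the block still computes A ([layer_split]).  A zero singular value needs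
    no pseudoinverse, because its root is again 0.  All the singular values of
    A' and L are k-th roots of those of A, or 0, hence at most
    sigma1(A)^(1/k) <= M^(1/k); at most (k - 1) n layers are inserted in the
    whole network ([network_split]).

    Two facts about matrices carry this.  First, [sigma1] is the largest entry
    of S in any decomposition U S V^T ([sigma1_le], [le_sigma1]), because
    A^T A = V (S^T S) V^T is diagonal in the basis V.  Secondly, every
    real matrix has a singular value decomposition ([svd_exists]).  Up to
    transposition A has at least as many rows as columns.  A symmetric
    real matrix has a real eigenvalue ([symmetric_eigenvalue]); applied to
    A^T A it gives unit vectors u and v with A v = s u and u^T A = s v^T
    ([singular_pair]).  Householder reflections complete u and v to orthogonal
    matrices, in whose bases A is block diagonal with blocks s and a smaller
    matrix, and one concludes by induction. *)

(** * Real eigenvalues of symmetric matrices *)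

(** The characteristic polynomial has a complex root a; if v B = a v, then
    v B v^* = a |v|^2, where the left-hand side is real, B being Hermitian. *)
Lemma symmetric_eigenvalue (R : rcfType) n (B : 'M[R]_n) :
  (0 < n)%N -> B^T = B -> exists a, eigenvalue B a.
Proof.
move=> n_gt0 Bsym; pose C : numClosedFieldType := complex R.
pose toC : {rmorphism R -> C} := real_complex R.
have [a aP] := eigenvalue_closed (map_mx toC B) n_gt0.
suff a_real : a \is Num.real.
  by exists (complex.Re a); rewrite -(eigenvalue_map toC) [toC _]RRe_real.
have [v vB v_neq0] := eigenvalueP aP.
have Bherm : (map_mx toC B)^T = map_mx Num.conj (map_mx toC B).
  rewrite -[in LHS]Bsym; apply/matrixP => i j; rewrite !mxE.
  by rewrite conj_Creal //; apply/complex_realP; exists (B i j).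
pose w := map_mx Num.conj v^T.
have vw : 0 < (v *m w) 0 0 by rewrite -dotmxE dotmx_is_dotmx.
(* A 1 x 1 matrix equal to its own conjugate transpose is a real number. *)
have : (v *m map_mx toC B *m w) 0 0 \is Num.real.
  rewrite CrealE; apply/eqP.
  have -> (x : 'M[C]_1) : (x 0 0)^* = (map_mx Num.conj x^T) 0 0.
    by rewrite !mxE.
  rewrite !trmx_mul !map_mxM /= Bherm -!map_mx_comp mulmxA.
  congr (fun_of_matrix _ 0 0); congr (_ *m _ *m _);
    by apply/matrixP => i j; rewrite !mxE /= conjCK.
rewrite vB -scalemxAl mxE => avw_real.
rewrite -[a](mulfK (lt0r_neq0 vw)) realM // realV gtr0_real //.
Qed.

(** * Orthogonal matrices *)

Lemma orthogonal_mxC (R : realType) n (U : 'M[R]_n) :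
  orthogonal_mx U -> U *m U^T = 1%:M.
Proof. exact: mulmx1C. Qed.

Lemma orthogonal_mx_tr (R : realType) n (U : 'M[R]_n) :
  orthogonal_mx U -> orthogonal_mx U^T.
Proof. by move=> /orthogonal_mxC; rewrite /orthogonal_mx trmxK. Qed.

Lemma orthogonal_mxM (R : realType) n (U V : 'M[R]_n) :
  orthogonal_mx U -> orthogonal_mx V -> orthogonal_mx (U *m V).
Proof.
rewrite /orthogonal_mx => hU hV.
by rewrite trmx_mul -mulmxA (mulmxA U^T) hU mul1mx.
Qed.

Lemma row_sqnorm (R : realDomainType) n (v : 'rV[R]_n) :
  (v *m v^T) 0 0 = \sum_j v 0 j ^+ 2.
Proof. by rewrite mxE; apply: eq_bigr => j _; rewrite mxE expr2. Qed.

Lemma row_sqnorm_gt0 (R : realDomainType) n (v : 'rV[R]_n) :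
  v != 0 -> 0 < (v *m v^T) 0 0.
Proof.
move=> v_neq0; rewrite row_sqnorm lt0r sumr_ge0 ?andbT; last first.
  by move=> j _; exact: sqr_ge0.
apply: contra v_neq0; rewrite psumr_eq0; last by move=> j _; exact: sqr_ge0.
move=> /allP v0; apply/eqP/rowP => j; rewrite mxE; apply/eqP.
by rewrite -sqrf_eq0; exact: v0 (mem_index_enum j).
Qed.

Lemma normalize_row (R : rcfType) n (v : 'rV[R]_n) :
  v != 0 -> exists2 c, c != 0 & (c *: v) *m (c *: v)^T = 1%:M.
Proof.
move=> /row_sqnorm_gt0 v_gt0; set d := (v *m v^T) 0 0 in v_gt0.
exists (Num.sqrt d)^-1; first by rewrite invr_neq0 // gt_eqF // sqrtr_gt0.
rewrite linearZ /= -scalemxAl -scalemxAr scalerA [v *m _]mx11_scalar -/d.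
rewrite -invfM -expr2 sqr_sqrtr ?ltW // -scalemx1 scalerA mulVf ?scale1r //.
by rewrite gt_eqF.
Qed.

(** Any unit vector v starts an orthonormal basis: with u = v - e nonzero, the
    Householder reflection 1 - 2 u^T u / |u|^2 exchanges e and v, and its first
    row is the image of e. *)
Lemma orthogonal_mx_row0 (R : realType) n (v : 'rV[R]_n.+1) :
  v *m v^T = 1%:M -> exists2 H : 'M[R]_n.+1, orthogonal_mx H & row 0 H = v.
Proof.
move=> v1; pose e : 'rV[R]_n.+1 := delta_mx 0 0.
have [-> | v_neq] := eqVneq v e.
  by exists 1%:M; rewrite /orthogonal_mx ?trmx1 ?mulmx1 // rowE mulmx1.
pose u := v - e; have u_neq0 : u != 0 by rewrite subr_eq0.
have d_gt0 := row_sqnorm_gt0 u_neq0; set d := (u *m u^T) 0 0 in d_gt0.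
have uu : u *m u^T = d%:M by rewrite [LHS]mx11_scalar.
pose c := 2 / d.
have cd : c * d = 2 by rewrite divfK // gt_eqF.
pose H : 'M[R]_n.+1 := 1%:M - c *: (u^T *m u).
have Htr : H^T = H by rewrite linearB /= linearZ /= trmx_mul trmxK trmx1.
have uH : u *m H = - u.
  rewrite mulmxBr mulmx1 -scalemxAr mulmxA uu mul_scalar_mx scalerA cd.
  by rewrite scaler_nat mulr2n opprD addrA subrr add0r.
exists H.
  rewrite /orthogonal_mx Htr {1}/H mulmxBl mul1mx -scalemxAl -mulmxA uH.
  by rewrite mulmxN scalerN opprK subrK.
have ve : v *m e^T = (v 0 0)%:M.
  by rewrite [LHS]mx11_scalar trmx_delta -colE mxE.
have ee : e *m e^T = 1%:M.
  by rewrite trmx_delta mul_delta_mx [LHS]mx11_scalar mxE.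
have ev : e *m v^T = (v 0 0)%:M.
  by rewrite -[LHS]trmxK trmx_mul trmxK ve tr_scalar_mx.
have eu : e *m u^T = (v 0 0 - 1)%:M by rewrite linearB /= mulmxBr ev ee raddfB.
(* |v - e|^2 = |v|^2 - 2 <v, e> + |e|^2, where v and e are unit vectors. *)
have dE : d = 2 * (1 - v 0 0).
  rewrite /d linearB /= mulmxBr !mulmxBl v1 ve ev ee !mxE eqxx.
  by rewrite !mulr1n; ring.
rewrite rowE -/e mulmxBr mulmx1 -scalemxAr mulmxA eu mul_scalar_mx scalerA.
have -> : c * (v 0 0 - 1) = -1.
  apply: (mulfI (x := 2)); first by rewrite pnatr_eq0.
  by rewrite mulrCA -opprB mulrN -dE mulrN cd mulrN1.
by rewrite scaleN1r opprK addrC subrK.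
Qed.

(** * Existence of the singular value decomposition *)

(** The vector v is a unit eigenvector of A^T A, and u is v A^T normalized.  When
    v A^T = 0, A is not of full column rank, and u is any unit vector of the left
    kernel, which is nonzero because A has at least as many rows as columns:
    this is why the shape of A is restricted. *)
Lemma singular_pair (R : realType) m n (A : 'M[R]_(m.+1, n.+1)) :
  (n <= m)%N ->
  exists (s : R) (u : 'rV[R]_m.+1) (v : 'rV[R]_n.+1),
    [/\ 0 <= s, u *m u^T = 1%:M, v *m v^T = 1%:M,
        u *m A = s *: v & v *m A^T = s *: u].
Proof.
move=> le_nm.
have [a /eigenvalueP[v0 v0A v0_neq0]] : exists a, eigenvalue (A^T *m A) a.
  by apply: symmetric_eigenvalue => //; rewrite trmx_mul trmxK.
have [c c_neq0] := normalize_row v0_neq0; set v := c *: v0 => vv.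
have vA : v *m A^T *m A = a *: v.
  by rewrite -mulmxA -scalemxAl v0A !scalerA mulrC.
pose w := v *m A^T.
have ww : w *m w^T = a%:M.
  by rewrite trmx_mul trmxK mulmxA vA -scalemxAl vv scalemx1.
have aE : (w *m w^T) 0 0 = a by rewrite ww mxE eqxx.
have a_ge0 : 0 <= a.
  by rewrite -aE row_sqnorm sumr_ge0 // => j _; exact: sqr_ge0.
have [w0 | w_neq0] := eqVneq w 0.
  (* v <> 0 in the right kernel forces rank A < n + 1 <= m + 1. *)
  have : kermx A != 0.
    rewrite kermx_eq0 -row_leq_rank -ltnNge.
    apply: (@leq_trans n.+1); last by [].
    rewrite -(mxrank_tr A) ltnS leqNgt; apply/negP => full.
    have : row_free A^T by rewrite -row_leq_rank.
    move=> /row_freeP[B AB]; have : v *m A^T *m B == 0 by rewrite -/w w0 mul0mx.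
    rewrite -mulmxA AB mulmx1 => /eqP v_eq0.
    move: vv; rewrite v_eq0 mul0mx => /matrixP/(_ 0 0)/eqP.
    by rewrite !mxE eq_sym oner_eq0.
  case/rowV0Pn => u0 /sub_kermxP u0A u0_neq0.
  have [b b_neq0 uu] := normalize_row u0_neq0.
  exists 0, (b *: u0), v; split=> //.
    by rewrite -scalemxAl u0A scaler0 scale0r.
  by rewrite -/w w0 scale0r.
have a_gt0 : 0 < a by rewrite -aE row_sqnorm_gt0.
pose s := Num.sqrt a; have s_neq0 : s != 0 by rewrite gt_eqF ?sqrtr_gt0.
have ss : s * s = a by rewrite -expr2 sqr_sqrtr.
exists s, (s^-1 *: w), v; split=> //.
- exact: sqrtr_ge0.
- rewrite [(s^-1 *: w)^T]linearZ /= -scalemxAl -[w *m _]scalemxAr ww scalerA.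
  rewrite -[a%:M]scalemx1 scalerA.
  by rewrite -invfM ss mulVf ?scale1r // gt_eqF.
- by rewrite -scalemxAl vA scalerA -ss mulKf.
- by rewrite scalerA mulfV ?scale1r.
Qed.

Lemma block1_orthogonal (R : realType) n (U : 'M[R]_n) :
  orthogonal_mx U -> orthogonal_mx (block_mx 1%:M 0 0 U : 'M_(1 + n)).
Proof.
rewrite /orthogonal_mx tr_block_mx mulmx_block => ->.
by rewrite !trmx1 !trmx0 !mulmx0 !mul0mx mulmx1 !addr0 add0r -scalar_mx_block.
Qed.

Lemma block_of_row_col0 (R : pzRingType) m n (C : 'M[R]_(1 + m, 1 + n)) s :
  row 0 C = s *: delta_mx 0 0 -> row 0 C^T = s *: delta_mx 0 0 ->
  C = block_mx s%:M 0 0 (drsubmx C).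
Proof.
move=> row0C col0C.
rewrite -{1}[C]submxK; congr block_mx; apply/matrixP => i j.
- have /rowP/(_ 0) := row0C; rewrite !mxE !ord1 /= mulr1 => <-.
  by congr (fun_of_matrix _ _ _); apply: val_inj.
- have /rowP/(_ (rshift 1 j)) := row0C; rewrite !mxE !ord1 /= mulr0 => <-.
  by congr (fun_of_matrix _ _ _); apply: val_inj.
- have /rowP/(_ (rshift 1 i)) := col0C; rewrite !mxE !ord1 /= mulr0 => <-.
  by congr (fun_of_matrix _ _ _); apply: val_inj.
Qed.

(** The singular pair of A splits off a 1 x 1 block in orthogonal bases that
    start with u and v; the other block has one row and one column less, so it
    still has at least as many rows as columns. *)
Lemma svd_tall (R : realType) n m (A : 'M[R]_(m, n)) :
  (n <= m)%N -> exists U S V, is_svd A U S V.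
Proof.
elim: n m A => [|n IHn] [|m] // A le_nm.
- exists 1%:M, A, 1%:M.
  split; rewrite /orthogonal_mx ?trmx1 ?mulmx1 ?mul1mx //.
  by split; [apply/is_diag_mxP => - [] | case].
- exists 1%:M, A, 1%:M.
  split; rewrite /orthogonal_mx ?trmx1 ?mulmx1 ?mul1mx //.
  by split; [apply/is_diag_mxP => i [] | move=> i []].
have [s [u [v [s_ge0 uu vv uA vA]]]] := singular_pair A le_nm.
have [P Porth Pu] := orthogonal_mx_row0 uu.
have [Q Qorth Qv] := orthogonal_mx_row0 vv.
pose C : 'M[R]_(1 + m, 1 + n) := P *m A *m Q^T.
have row0C : row 0 C = s *: delta_mx 0 0.
  rewrite !row_mul Pu uA -scalemxAl -Qv -row_mul orthogonal_mxC //.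
  by rewrite rowE mulmx1.
have col0C : row 0 C^T = s *: delta_mx 0 0.
  rewrite !trmx_mul trmxK mulmxA !row_mul Qv vA -scalemxAl -Pu -row_mul.
  by rewrite orthogonal_mxC // rowE mulmx1.
have CE : C = block_mx s%:M 0 0 (drsubmx C) by exact: block_of_row_col0.
have [U [S [V [Uorth [Sdiag S_ge0] Vorth DE]]]] := IHn _ (drsubmx C) le_nm.
pose U1 : 'M[R]_(1 + m) := block_mx 1%:M 0 0 U.
pose S1 : 'M[R]_(1 + m, 1 + n) := block_mx s%:M 0 0 S.
pose V1 : 'M[R]_(1 + n) := block_mx 1%:M 0 0 V.
have S1_diag : nneg_diag S1.
  split; first by rewrite /S1 is_diag_block_mx // !eqxx Sdiag mx11_is_diag.
  move=> i j; rewrite -(splitK i) -(splitK j).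
  case: (split i) => i'; case: (split j) => j' /=;
    rewrite ?block_mxEul ?block_mxEur ?block_mxEdl ?block_mxEdr ?mxE //.
  by rewrite !ord1.
have C_svd : C = U1 *m S1 *m V1^T.
  rewrite CE DE /U1 /S1 /V1 tr_block_mx !mulmx_block !trmx1 !trmx0.
  by rewrite !(mul0mx, mulmx0, mul1mx, mulmx1, addr0, add0r).
exists (P^T *m U1), S1, (Q^T *m V1); split.
- apply: orthogonal_mxM; first exact: orthogonal_mx_tr.
  exact: block1_orthogonal.
- exact: S1_diag.
- apply: orthogonal_mxM; first exact: orthogonal_mx_tr.
  exact: block1_orthogonal.
have -> : A = P^T *m C *m Q.
  rewrite /C mulmxA -[RHS]mulmxA -!mulmxA Qorth mulmx1 mulmxA.
  by rewrite [P^T *m P]Porth mul1mx.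
by rewrite C_svd trmx_mul trmxK !mulmxA.
Qed.

Lemma is_svd_tr (R : realType) m n (A : 'M[R]_(m, n)) U S V :
  is_svd A U S V -> is_svd A^T V S^T U.
Proof.
case=> Uorth [Sdiag S_ge0] Vorth ->; split=> //.
  by split=> [|i j]; rewrite ?is_diag_trmx ?mxE.
by rewrite !trmx_mul trmxK mulmxA.
Qed.

Lemma svd_exists (R : realType) m n (A : 'M[R]_(m, n)) :
  exists U S V, is_svd A U S V.
Proof.
have [le_nm | /ltnW le_mn] := leqP n m; first exact: svd_tall.
have [U [S [V svdA]]] := svd_tall A^T le_mn.
by exists V, S^T, U; rewrite -[A]trmxK; exact: is_svd_tr.
Qed.

(** * The spectral norm in a singular value decomposition *)

(** A row of a rectangular diagonal matrix has at most one nonzero entry, so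
    its sum reads off this entry; unlike the entry itself, the sum also makes
    sense, with value 0, for a row that lies below the diagonal. *)
Lemma diag_row_sum (V : nmodType) m n (T : 'M[V]_(m, n)) (i : 'I_m) (j : 'I_n) :
  is_diag_mx T -> i = j :> nat -> \sum_k T i k = T i j.
Proof.
move=> /is_diag_mxP Tdiag ij; rewrite (bigD1 j) //= big1 ?addr0 // => k kj.
by apply: Tdiag; rewrite ij eq_sym.
Qed.

Lemma diag_row_sum_le (R : numDomainType) m n (T : 'M[R]_(m, n)) (c : R) i :
  is_diag_mx T -> 0 <= c -> (forall k j, T k j <= c) -> \sum_j T i j <= c.
Proof.
move=> Tdiag c_ge0 T_le.
have [j ij | noj] := pickP (fun j : 'I_n => i == j :> nat).
  by rewrite (diag_row_sum Tdiag (eqP ij)).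
by rewrite big1 // => j _; apply: (is_diag_mxP Tdiag); rewrite noj.
Qed.

Lemma eigenvalue_orthogonal_diag (R : realType) n (V : 'M[R]_n)
    (d : 'rV[R]_n) a :
  orthogonal_mx V ->
  eigenvalue (V *m diag_mx d *m V^T) a <-> exists j, a = d 0 j.
Proof.
move=> Vorth; have VV := orthogonal_mxC Vorth; split.
  case/eigenvalueP => v vA v_neq0; pose w := v *m V.
  have w_neq0 : w != 0.
    apply: contra v_neq0 => /eqP w0.
    by rewrite -[v]mulmx1 -VV mulmxA -/w w0 mul0mx.
  have wd : w *m diag_mx d = a *: w.
    by rewrite scalemxAl -vA -!mulmxA Vorth mulmx1.
  have [j wj] : exists j, w 0 j != 0.
    apply/existsP; apply: contraR w_neq0 => /existsPn w0.
    by apply/eqP/rowP => j; rewrite [RHS]mxE; apply/eqP/negPn; exact: w0.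
  exists j; apply: (mulIf wj).
  by have /rowP/(_ j) := wd; rewrite mul_mx_diag !mxE mulrC => ->.
case=> j ->; apply/eigenvalueP; exists (row j V^T).
  rewrite -row_mul !mulmxA [V^T *m V]Vorth mul1mx.
  by apply/rowP => k; rewrite mul_diag_mx !mxE.
apply: contraTneq isT => /(congr1 (mulmx^~ V)).
rewrite -row_mul [V^T *m V]Vorth mul0mx => /rowP/(_ j)/eqP.
by rewrite !mxE eqxx oner_eq0.
Qed.

Lemma diag_gram (R : realDomainType) m n (S : 'M[R]_(m, n)) :
  is_diag_mx S -> S^T *m S = diag_mx (\row_j \sum_i S i j ^+ 2).
Proof.
move=> /is_diag_mxP Sdiag; apply/matrixP => j k; rewrite !mxE.
have [<- | jk] := eqVneq j k.
  by rewrite mulr1n; apply: eq_bigr => i _; rewrite mxE expr2.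
rewrite mulr0n big1 // => i _; rewrite mxE.
have [ij | ij] := eqVneq (i : nat) j; last by rewrite Sdiag ?mul0r.
by rewrite [S i k]Sdiag ?mulr0 // ij.
Qed.

(** A^T A = V (S^T S) V^T has the eigenvalues of the diagonal matrix S^T S, whose
    entries are the sums of squares of the columns of S. *)
Lemma singular_value_svd (R : realType) m n (A : 'M[R]_(m, n)) U S V s :
  is_svd A U S V ->
  singular_value A s <-> 0 <= s /\ exists j, s ^+ 2 = \sum_i S i j ^+ 2.
Proof.
case=> Uorth [Sdiag _] Vorth ->; rewrite /singular_value.
have -> : (U *m S *m V^T)^T *m (U *m S *m V^T) = V *m (S^T *m S) *m V^T.
  by rewrite !trmx_mul trmxK !mulmxA -[_ *m U^T *m U]mulmxA Uorth mulmx1.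
rewrite diag_gram //; split=> -[s_ge0].
  move=> /(eigenvalue_orthogonal_diag _ _ Vorth)[j ->]; split=> //.
  by exists j; rewrite mxE.
case=> j sE; split=> //; apply/eigenvalue_orthogonal_diag => //.
by exists j; rewrite mxE.
Qed.

Lemma singular_value_le (R : realType) m n (A : 'M[R]_(m, n)) U S V c s :
  is_svd A U S V -> 0 <= c -> (forall i j, S i j <= c) ->
  singular_value A s -> s <= c.
Proof.
move=> svdA c_ge0 S_le /(singular_value_svd _ svdA)[s_ge0 [j sE]].
case: svdA => _ [Sdiag S_ge0] _ _.
rewrite -(@ler_pXn2r _ 2) ?nnegrE // sE.
pose T := map_mx (fun x => x ^+ 2) S^T.
have -> : \sum_i S i j ^+ 2 = \sum_i T j i.
  by apply: eq_bigr => i _; rewrite !mxE.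
apply: diag_row_sum_le; last 1 first.
- by move=> k i; rewrite !mxE ler_pXn2r ?nnegrE.
- apply/is_diag_mxP => k i ki; rewrite !mxE (is_diag_mxP Sdiag) ?expr0n //.
  by rewrite eq_sym.
- exact: exprn_ge0.
Qed.

(** The empty set of singular values, which occurs when n = 0, has supremum 0. *)
Lemma sigma1_le (R : realType) m n (A : 'M[R]_(m, n)) U S V c :
  is_svd A U S V -> 0 <= c -> (forall i j, S i j <= c) -> sigma1 A <= c.
Proof.
move=> svdA c_ge0 S_le; rewrite /sigma1.
have [[s0 s0P] | noS] := pselect (exists s, singular_value A s); last first.
  by rewrite sup_out // => -[[s sP] _]; apply: noS; exists s.
apply: ge_sup; first by exists s0.
by move=> s; exact: singular_value_le svdA c_ge0 S_le.
Qed.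

Lemma sigma1_ge0 (R : realType) m n (A : 'M[R]_(m, n)) : 0 <= sigma1 A.
Proof.
rewrite /sigma1.
have [supA | /sup_out -> //] := pselect (has_sup [set s | singular_value A s]).
have [[s sP] _] := supA; case: (sP) => s_ge0 _.
exact: le_trans s_ge0 (sup_upper_bound supA sP).
Qed.

Lemma le_sigma1 (R : realType) m n (A : 'M[R]_(m, n)) U S V i j :
  is_svd A U S V -> S i j <= sigma1 A.
Proof.
move=> svdA; case: (svdA) => _ [Sdiag S_ge0] _ _.
have [ij | ij] := eqVneq (i : nat) j; last first.
  by rewrite (is_diag_mxP Sdiag) // sigma1_ge0.
have Sij : singular_value A (S i j).
  apply/(singular_value_svd _ svdA); split=> //; exists j.
  rewrite (bigD1 i) //= big1 ?addr0 // => k ki.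
  by rewrite (is_diag_mxP Sdiag) ?expr0n // -ij.
apply: (ub_le_sup _ Sij).
(* Any upper bound of the entries of S bounds the set of singular values. *)
have sum_ge0 k : 0 <= \sum_l S k l by exact: sumr_ge0.
exists (\sum_k \sum_l S k l) => s; apply: (singular_value_le svdA).
  exact: sumr_ge0.
move=> k l; rewrite (bigD1 k) //= (bigD1 l) //= -addrA lerDl.
by rewrite addr_ge0 ?sumr_ge0.
Qed.

(** * Splitting one layer *)

(** The square matrix with the diagonal of T, padded with zeros if T is tall;
    the row sums avoid a case distinction on whether T is tall or wide. *)
Definition diag_square (V : nmodType) m n (T : 'M[V]_(m, n)) : 'M[V]_m :=
  diag_mx (\row_i \sum_j T i j).

(** For i = 0 this fails: the entrywise power 0 is nonzero off the diagonal. *)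
Lemma diag_squareM (R : realType) m n (T : 'M[R]_(m, n)) i :
  is_diag_mx T -> (0 < i)%N ->
  diag_square T *m map_mx (fun x => x ^+ i) T =
    map_mx (fun x => x ^+ i.+1) T.
Proof.
move=> Tdiag i_gt0; apply/matrixP => a b; rewrite mul_diag_mx !mxE.
have [ab | ab] := eqVneq (a : nat) b.
  by rewrite (diag_row_sum Tdiag ab) exprS.
by rewrite (is_diag_mxP Tdiag) // !expr0n gtn_eqF // mulr0.
Qed.

(** Each factor meets the U in front of the diagonal part, where U^T U = 1, and
    raises the exponent by one. *)
Lemma layers_prod_nseq (R : realType) m n (U : 'M[R]_m) (T : 'M[R]_(m, n)) j i :
  orthogonal_mx U -> is_diag_mx T -> (0 < i)%N ->
  layers_prod (nseq j (U *m diag_square T *m U^T)) *m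
    (U *m map_mx (fun x => x ^+ i) T) =
    U *m map_mx (fun x => x ^+ (j + i)) T.
Proof.
move=> Uorth Tdiag; elim: j i => [|j IHj] i i_gt0 /=; first by rewrite mul1mx.
rewrite addSnnS -IHj // -mulmxA -diag_squareM // -!mulmxA.
by rewrite [U^T *m _]mulmxA Uorth mul1mx.
Qed.

Lemma powR_invn_expr (R : realType) (s : R) k :
  (0 < k)%N -> 0 <= s -> (s `^ k%:R^-1) ^+ k = s.
Proof.
move=> k_gt0 s_ge0; rewrite -powR_mulrn ?powR_ge0 // -powRrM mulVf ?powRr1 //.
by rewrite pnatr_eq0 -lt0n.
Qed.

(** All compensating layers go after the layer, in the basis U.  The root of 0 is
    0, so the entrywise root T of S stays diagonal, and the padding entries of
    [diag_square T] respect any nonnegative bound. *)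
Lemma layer_split (R : realType) m p (A : 'M[R]_(m, p)) k :
  (0 < k)%N ->
  exists (A' : 'M[R]_(m, p)) (post : seq 'M[R]_m),
    [/\ size post = k.-1, block_deformation A [::] A' post,
        sigma1 A' <= sigma1 A `^ k%:R^-1
      & forall L, L \in post -> sigma1 L <= sigma1 A `^ k%:R^-1].
Proof.
move=> k_gt0; have [U [S [V svdA]]] := svd_exists A.
case: (svdA) => Uorth [Sdiag S_ge0] Vorth AE.
have k_neq0 : k%:R^-1 != 0 :> R by rewrite invr_eq0 pnatr_eq0 -lt0n.
pose c := sigma1 A `^ k%:R^-1; have c_ge0 : 0 <= c := powR_ge0 _ _.
pose T := map_mx (fun x => x `^ k%:R^-1) S.
have T_ge0 i j : 0 <= T i j by rewrite mxE powR_ge0.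
have Tdiag : is_diag_mx T.
  by apply/is_diag_mxP => i j ij; rewrite mxE (is_diag_mxP Sdiag) // powR0.
have T_le i j : T i j <= c.
  rewrite mxE ge0_ler_powR ?invr_ge0 ?nnegrE ?sigma1_ge0 //.
  exact: le_sigma1 svdA.
have Tk : map_mx (fun x => x ^+ k) T = S.
  by apply/matrixP => i j; rewrite !mxE powR_invn_expr.
have svdA' : is_svd (U *m T *m V^T) U T V by [].
have svdL : is_svd (U *m diag_square T *m U^T) U (diag_square T) U.
  split=> //; split; first exact: diag_mx_is_diag.
  move=> i j; rewrite !mxE mulrn_wge0 //.
  by apply: sumr_ge0.
exists (U *m T *m V^T), (nseq k.-1 (U *m diag_square T *m U^T)); split.
- by rewrite size_nseq.
- exists U, S, T, V; split=> //.
    move=> L /nseqP[-> _]; case: svdL => _ nnegD _ LE.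
    by exists (diag_square T).
  have T1 : map_mx (fun x => x ^+ 1) T = T by apply/matrixP => i j; rewrite mxE.
  by rewrite mulmx1 mulmxA -{2}T1 layers_prod_nseq // addn1 prednK // Tk.
- exact: sigma1_le svdA' c_ge0 T_le.
- move=> L /nseqP[-> _]; apply: (sigma1_le svdL c_ge0) => i j; rewrite !mxE.
  by rewrite mulrb; case: ifP => _ //; exact: diag_row_sum_le Tdiag c_ge0 T_le.
Qed.

(** * Splitting all the layers of a network *)

Lemma eval_hidden_post (R : realType) q m p (A : 'M[R]_(m, p)) post phi
    (N : network R q m) x :
  eval (hidden_post A post phi N) x =
  eval N (map_mx phi (layers_prod post *m A *m x)).
Proof.
elim: post p A x => [|L post IHpost] p A x /=; first by rewrite mul1mx.
by rewrite IHpost [map_mx id _]map_mx_id // !mulmxA.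
Qed.

Lemma hidden_norms_post (R : realType) q m p (A : 'M[R]_(m, p)) post phi
    (N : network R q m) :
  hidden_norms (hidden_post A post phi N) =
  sigma1 A :: [seq sigma1 L | L <- post] ++ hidden_norms N.
Proof. by elim: post p A => [|L post IHpost] p A //=; rewrite IHpost. Qed.

(** The bound M is a parameter, so that the induction can pass to the tail of the
    network, whose own maximum may be smaller. *)
Lemma network_split (R : realType) p q (N : network R q p) k M :
  (0 < k)%N -> {in hidden_norms N, forall s, s <= M} ->
  exists X Y : xnetwork R q p,
    [/\ insertion N X, inserted X = (k.-1 * depth N)%N,
        spectral_deformation X Y,
        eval (flatten_net Y) =1 eval N
      & {in hidden_norms (flatten_net Y), forall s, s <= M `^ k%:R^-1}].
Proof.
move=> k_gt0; elim: N => [{}p A | {}p m A phi N IHN] /= N_le.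
  exists (XReadout A), (XReadout A).
  by split=> //; [constructor | rewrite muln0 | constructor].
have A_le : sigma1 A `^ k%:R^-1 <= M `^ k%:R^-1.
  have sA := N_le _ (mem_head _ _).
  rewrite ge0_ler_powR ?nnegrE ?invr_ge0 ?sigma1_ge0 //.
  exact: le_trans (sigma1_ge0 A) sA.
have [|X [Y [NX XE XY evalY Y_le]]] := IHN.
  by move=> s sN; apply: N_le; rewrite inE sN orbT.
have [A' [post [post_size AA' A'_le post_le]]] := layer_split A k_gt0.
exists (XHidden (nseq 0 1%:M) A (nseq k.-1 1%:M) phi X).
exists (XHidden [::] A' post phi Y); split.
- by constructor.
- by rewrite /= XE size_nseq add0n mulnS.
- by constructor; rewrite ?size_nseq.
- move=> x; rewrite /= eval_hidden_post evalY.
  by case: AA' => [U [S [T [V [_ _ _ _]]]]]; rewrite mulmx1 => ->.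
move=> s; rewrite /= hidden_norms_post inE mem_cat.
case/or3P => [/eqP-> | /mapP[L Ls ->] | ].
- exact: le_trans A'_le A_le.
- exact: le_trans (post_le _ Ls) A_le.
- exact: Y_le.
Qed.

Theorem theorem8 (R : realType) (p q : nat) (N : network R q p) (k : nat)
  (hk : (1 <= k)%N) :
  exists X Y : xnetwork R q p,
    [/\ insertion N X,
        (inserted X <= (k - 1) * depth N)%N,
        spectral_deformation X Y,
        (forall x : 'cV[R]_p, eval (flatten_net Y) x = eval N x)
      & max_sigma1 (flatten_net Y) <= max_sigma1 N `^ (k%:R^-1)].
Proof.
have N_le : {in hidden_norms N, forall s, s <= max_sigma1 N}.
  by move=> s sN; exact: (le_bigmax_seq 0 s xpredT id).
have [X [Y [NX XE XY evalY Y_le]]] := network_split hk N_le.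
exists X, Y; split=> //; first by rewrite XE subn1.
rewrite /max_sigma1 big_seq; apply: bigmax_le; first exact: powR_ge0.
by move=> s sY; exact: Y_le.
Qed.
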